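(* Let $X$ be a continuum such that $\mathcal{T}\colon 2^X\to 2^X$ is continuous. If $\mathcal{T}(\{p\})$ has nonempty interior in $X$ for some $p\in X$, then $X$ is indecomposable.
   Context: A continuum is a compact, connected, nonempty metric space; a subcontinuum of $X$ is a subset of $X$ that is a continuum. A continuum is decomposable if it is the union of two proper subcontinua, and indecomposable otherwise. For a continuum $X$, $2^X$ denotes the set of all nonempty closed subsets of $X$ with the Hausdorff metric. Jones' set function $\mathcal{T}$ is defined for every $A\subseteq X$ by $$\mathcal{T}(A)=X\setminus\{x\in X : \text{there is a subcontinuum } W \text{ of } X \text{ with } x\in W^{\circ}\subseteq W\subseteq X\setminus A\},$$ where $W^\circ$ is the interior of $W$ in $X$. If $A\in 2^X$ then $\mathcal{T}(A)\in 2^X$, and continuity of $\mathcal{T}$ refers to its restriction $2^X\to 2^X$. *)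

(* Defs.v *)
From HB Require Import structures.
From mathcomp Require Import all_boot all_order all_algebra.
From mathcomp Require Import all_classical all_reals all_analysis.

Set Implicit Arguments.
Unset Strict Implicit.
Unset Printing Implicit Defensive.

Import Order.TTheory GRing.Theory Num.Theory.

Local Open Scope classical_set_scope.
Local Open Scope ring_scope.

(* [compact W] and [connected W] only depend on the subspace topology of [W],
   so the same predicate expresses that the whole space is a continuum
   ([continuum [set: X]]) and that a subset is a subcontinuum. *)
Definition continuum (R : realType) (X : metricType R) (W : set X) : Prop :=
  [/\ compact W, connected W & W !=set0].

Definition decomposable (R : realType) (X : metricType R) : Prop :=
  exists A B : set X,
    [/\ continuum A, continuum B, A `<` [set: X], B `<` [set: X]
      & A `|` B = [set: X]].

Definition indecomposable (R : realType) (X : metricType R) : Prop :=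
  ~ decomposable X.

Definition jones (R : realType) (X : metricType R) (A : set X) : set X :=
  ~` [set x | exists W : set X, [/\ continuum W, W° x & W `<=` ~` A]].

(* The carrier of 2^X. It is indexed by the proof that X is a continuum because
   the Hausdorff distance is a (finite) metric only when X is bounded. *)
Record hyperspace (R : realType) (X : metricType R)
    (cX : continuum [set: X]) : Type := Hyperspace {
  hyperspace_set :> set X ;
  hyperspace_closed : closed hyperspace_set ;
  hyperspace_neq0 : hyperspace_set !=set0 }.

Definition set_ball (R : realType) (X : metricType R) (A : set X) (e : R) :
    set X :=
  [set x | exists2 a, A a & mdist a x < e].

Definition hausdorff_radii (R : realType) (X : metricType R) (A B : set X) :
    set R :=
  [set e | [/\ 0 < e, A `<=` set_ball B e & B `<=` set_ball A e]].

Definition hausdorff_dist (R : realType) (X : metricType R) (A B : set X) : R :=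
  inf (hausdorff_radii A B).

Section hausdorff_metric.
Context {R : realType} {X : metricType R} (cX : continuum [set: X]).
Implicit Types A B C : hyperspace cX.

Lemma hyperspace_eq A B : A = B :> set X -> A = B.
Proof.
case: A B => [A clA A0] [B clB B0] /= AB.
by subst B; rewrite (Prop_irrelevance clA clB) (Prop_irrelevance A0 B0).
Qed.

Lemma continuum_bounded : exists2 M : R, 0 < M & forall x y : X, mdist x y < M.
Proof.
have [cptX _ [p _]] := cX.
have /compact_near_coveringP nX := cptX.
have : \forall i \near +oo%R, [set: X] `<=` [set x | mdist p x < i].
  apply: nX => x _.
  exists (ball x 1, [set i | mdist p x + 1 < i]) => /=.
    split; first exact: nbhsx_ballx.
    by apply: nbhs_pinfty_gt; exact: num_real.
  move=> [y i] /= [+ xi]; rewrite ballEmdist /= => xy.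
  by rewrite (le_lt_trans (metric_triangle p x y))// (lt_trans _ xi)// ltrD2l.
move=> nM.
have [M [M0 hM]] : exists M : R, 0 < M /\ [set: X] `<=` [set x | mdist p x < M].
  near (+oo%R : set_system R) => M; exists M; split.
    by near: M; exact: nbhs_pinfty_gt.
  by near: M.
exists (M + M); first by rewrite addr_gt0.
move=> x y; rewrite (le_lt_trans (metric_triangle x p y))// ltrD//.
  by rewrite metric_sym; exact: hM.
exact: hM.
Unshelve. all: by end_near. Qed.

Lemma hausdorff_radii_has_inf A B : has_inf (hausdorff_radii A B).
Proof.
split; last by exists 0 => e [/ltW].
have [M M0 hM] := continuum_bounded; exists M; split => //.
- by move=> x _; have [b Bb] := hyperspace_neq0 B; exists b => //; exact: hM.
- by move=> x _; have [a Aa] := hyperspace_neq0 A; exists a => //; exact: hM.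
Qed.

Lemma hausdorff_dist_adherent A B (e : R) : 0 < e ->
  exists2 d, hausdorff_radii A B d & d < hausdorff_dist A B + e.
Proof. by move=> e0; exact: inf_adherent e0 (hausdorff_radii_has_inf A B). Qed.

Lemma hausdorff_dist_le A B (e : R) :
  hausdorff_radii A B e -> hausdorff_dist A B <= e.
Proof. by apply: ge_inf; have [] := hausdorff_radii_has_inf A B. Qed.

Lemma hausdorff_radii_sym (A B : set X) :
  hausdorff_radii A B = hausdorff_radii B A.
Proof. by apply/seteqP; split => e []. Qed.

Lemma hausdorff_dist_sym A B : hausdorff_dist A B = hausdorff_dist B A.
Proof. by rewrite /hausdorff_dist hausdorff_radii_sym. Qed.

Lemma hausdorff_dist_ge0 A B : 0 <= hausdorff_dist A B.
Proof.
apply: lb_le_inf; first by have [] := hausdorff_radii_has_inf A B.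
by move=> e [/ltW].
Qed.

Lemma hausdorff_distxx A : hausdorff_dist A A = 0.
Proof.
apply/eqP; rewrite eq_le hausdorff_dist_ge0 andbT.
apply/ler_addgt0Pl => e e0; rewrite addr0; apply: hausdorff_dist_le.
by split=> // x Ax; exists x => //; rewrite mdistxx.
Qed.

Lemma hausdorff_dist0_subset A B : hausdorff_dist A B = 0 -> A `<=` B.
Proof.
move=> AB0 x Ax; apply: (hyperspace_closed (h := B)) => U /nbhs_ballP[e /= e0 eU].
have [d [_ AB _]] := hausdorff_dist_adherent A B e0.
rewrite AB0 add0r => de.
have [b Bb bx] := AB _ Ax; exists b; split => //; apply: eU.
by rewrite ballEmdist /= metric_sym (lt_trans bx).
Qed.

Lemma hausdorff_dist_positivity A B : hausdorff_dist A B = 0 -> A = B.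
Proof.
move=> AB0; apply: hyperspace_eq; apply/seteqP; split.
  exact: hausdorff_dist0_subset.
by apply: hausdorff_dist0_subset; rewrite hausdorff_dist_sym.
Qed.

Lemma set_ball_trans (A B C : set X) (d e : R) :
  A `<=` set_ball B d -> B `<=` set_ball C e -> A `<=` set_ball C (d + e).
Proof.
move=> AB BC x /AB[b /BC[c Cc cb] bx]; exists c => //.
by rewrite (le_lt_trans (metric_triangle c b x))// addrC ltrD.
Qed.

Lemma hausdorff_dist_triangle B A C :
  hausdorff_dist A C <= hausdorff_dist A B + hausdorff_dist B C.
Proof.
apply/ler_addgt0Pr => e e0.
have e20 : 0 < e / 2 by rewrite divr_gt0.
have [d [d0 AB BA] dAB] := hausdorff_dist_adherent A B e20.
have [d' [d'0 BC CB] dBC] := hausdorff_dist_adherent B C e20.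
rewrite (@le_trans _ _ (d + d'))//.
  apply: hausdorff_dist_le; split; first by rewrite addr_gt0.
    exact: set_ball_trans AB BC.
  by rewrite addrC; exact: set_ball_trans CB BA.
by rewrite [e]splitr addrACA lerD// ltW.
Qed.

HB.instance Definition _ := gen_eqMixin (hyperspace cX).
HB.instance Definition _ := gen_choiceMixin (hyperspace cX).
HB.instance Definition _ := @isMetric.Build R (hyperspace cX)
  (fun A B => hausdorff_dist A B) hausdorff_distxx hausdorff_dist_positivity
  hausdorff_dist_sym hausdorff_dist_triangle.

End hausdorff_metric.

Section jones_hyperspace.
Context {R : realType} {X : metricType R}.

Lemma subset_jones (A : set X) : A `<=` jones A.
Proof. by move=> x Ax [W [_ /interior_subset Wx WA]]; exact: WA Wx Ax. Qed.

Lemma closed_jones (A : set X) : closed (jones A).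
Proof.
apply: open_closedC; rewrite openE => x [W [cW Wx WA]].
by apply: filterS (nbhs_interior Wx) => y Wy; exists W.
Qed.

Lemma jones_neq0 (A : set X) : A !=set0 -> jones A !=set0.
Proof. by move=> [x /subset_jones]; exists x. Qed.

End jones_hyperspace.

Definition jones_hyperspace (R : realType) (X : metricType R)
    (cX : continuum [set: X]) (A : hyperspace cX) : hyperspace cX :=
  Hyperspace cX (@closed_jones R X A) (jones_neq0 (hyperspace_neq0 A)).

(* Main.v *)
Require Import Defs.
From mathcomp Require Import all_boot all_order all_algebra.
From mathcomp Require Import all_classical all_reals all_analysis.

(* Write T for [jones] and U for the interior of T({p}), and suppose that X is
   decomposable. Continuity gives T(X \ W°) = X \ W° for every subcontinuum W;
   hence T is idempotent and every subcontinuum whose interior meets U contains p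
   in its interior.

   Let C be a closed set with T(C) = C and W a subcontinuum missing C, with
   p in W°, such that U is not contained in the union of C and W. If T(C U {z})
   reached out of the union of C and W for every z in W, then X \ W° would split
   into closed sets Q1 and Q2, and the set of the x such that T(C U {x}) meets
   both Q1 and Q2 inside W would be a proper nonempty clopen set. So
   T(C U {z}) = C U T({z}) with T({z}) contained in W for some z in W: the set C
   can be enlarged to a bigger fixed set of T, by adding T({m}) for a minimal
   point m.

   Take F maximal among the fixed sets of T made of minimal points outside U,
   and G maximal among those, not necessarily outside U, which contain F. The
   point p is not minimal, so it is not in G. If G contains U, the enlargement
   applies to F and a W missing G, otherwise it applies to G; both contradict
   maximality. *)

Import Order.TTheory GRing.Theory Num.Theory.

Local Open Scope classical_set_scope.
Local Open Scope ring_scope.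

(** * Compactness and connectedness in topological spaces *)

Section topology.
Context {T : topologicalType}.
Implicit Types A B E H K : set T.

(** For [A] in [P], the members of [P] containing [A] form a base of the filter [F], because [P] is
    closed under unions. The near-covering form of compactness makes the local hypothesis uniform
    along [F]. This replaces the extraction of finite subcovers. *)
Lemma compact_covering_ind {K} (P : set (set T)) : compact K -> P set0 ->
    (forall A B, P A -> P B -> P (A `|` B)) ->
    (forall x, K x -> exists2 A, nbhs x A & P A) ->
  exists2 A, P A & K `<=` A.
Proof.
move=> /compact_near_coveringP cK P0 PU PK.
pose F := filter_from P (fun A => [set B | P B /\ A `<=` B]).
have FF : Filter F.
  apply: filter_from_filter; first by exists set0.
  move=> A B PA PB; exists (A `|` B); first exact: PU.
  by move=> C [PC ABC]; split; split=> // x ?; apply: ABC; [left|right].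
have [A PA AK] : \forall A \near F, K `<=` A.
  apply: (cK _ F (fun A x => A x)) => x /PK[A xA PA].
  exists (A, [set B | P B /\ A `<=` B]); first by split=> //; exists A.
  by move=> [y B] /= [Ay [_ AB]]; exact: AB.
by exists A => //; apply: AK; split.
Qed.

Lemma not_connected_split {K} : closed K -> ~ connected K ->
  exists H1 H2, [/\ closed H1 /\ closed H2, H1 !=set0 /\ H2 !=set0,
    H1 `<=` ~` H2 & K = H1 `|` H2].
Proof.
move=> clK nK; apply: contrapT => nH; apply: nK => B B0 [V oV BV] [C clC BC].
apply: contrapT => BK; apply: nH; exists B, (K `&` ~` V); split.
- by split; [rewrite BC; exact: closedI|apply: closedI => //; exact: open_closedC].
- split=> //; apply: contrapT => KV; apply: BK; rewrite BV; apply/seteqP.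
  split=> [x [] //|x Kx]; split=> //; apply: contrapT => Vx.
  by apply: KV; exists x.
- by rewrite BV => x [_ Vx] [_].
- rewrite BV; apply/seteqP; split=> [x Kx|x [[]|[]]//].
  by have [|] := pselect (V x); [left|right].
Qed.

Lemma connected_sub_closed {E H1 H2} : connected E -> closed H1 -> closed H2 ->
  E `<=` H1 `|` H2 -> E `&` H1 `<=` ~` H2 -> E `&` H1 !=set0 -> E `<=` H1.
Proof.
move=> cE cl1 cl2 E12 H12 EH1 x Ex.
suff EE : E `&` H1 = E by move: Ex; rewrite -EE => -[].
apply: cE => //; last by exists H1.
exists (~` H2); first exact: closed_openC.
apply/seteqP; split=> y [Ey yH]; split=> //; first exact: H12.
by have [|/yH] := E12 _ Ey.
Qed.

End topology.

(** * Splittings of closed subsets of a continuum *)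

Section metric_continuum.
Context {R : realType} {X : metricType R} (cX : continuum [set: X]).
Implicit Types A B C E H K O W : set X.

Lemma closed_compact {A} : closed A -> compact A.
Proof. by move=> clA; have [cT _ _] := cX; exact: subclosed_compact clA cT _. Qed.

Lemma continuum_closed {W} : continuum W -> closed W.
Proof. by move=> [cW _ _]; apply: compact_closed cW; exact: metric_hausdorff. Qed.

Lemma metric_closed1 (x : X) : closed [set x].
Proof.
exact/accessible_closed_set1/hausdorff_accessible/metric_hausdorff.
Qed.

Lemma closed_separation {A B} : closed A -> closed B -> A `<=` ~` B ->
  exists V, [/\ open V, A `<=` V & closure V `<=` ~` B].
Proof.
move=> clA clB AB.
have nX : normal_space X.
  by apply: compact_normal; [exact: metric_hausdorff|case: cX].
have [|N /set_nbhsP[V [oV AV VN]] NB] := nX A clA (~` B).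
  by apply/set_nbhsP; exists (~` B); split=> //; exact: closed_openC.
exists V; split=> //; exact: subset_trans (closure_subset VN) NB.
Qed.

Lemma clopenT_full {A} : open A -> closed A -> A !=set0 -> A = setT.
Proof.
move=> oA clA A0; have [_ cXT _] := cX.
by apply: cXT => //; exists A => //; rewrite setTI.
Qed.

(* Each splitting of [K] off the point [z] uses up a member of [s], so after
   finitely many of them the piece containing [z] is connected. *)
Lemma continuum_nbhs {K z} (s : seq (set X)) : closed K -> K° z ->
    (forall E, E \in s -> connected E /\ E `<=` K) ->
    (forall H1 H2, closed H1 -> closed H2 -> H2 !=set0 -> H1 `<=` ~` H2 ->
      K = H1 `|` H2 -> H1 z -> exists2 E, E \in s & E `&` H2 !=set0) ->
  exists W, [/\ continuum W, W° z & W `<=` K].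
Proof.
have [n] := ubnP (size s); elim: n => // n IHn in K s * => sn clK Kz sK split_s.
have [cK|/(not_connected_split clK)] := pselect (connected K).
  exists K; split=> //; split=> //; first exact: closed_compact.
  by exists z; exact: interior_subset.
move=> [A1 [A2 [[cl1 cl2] [A10 A20] A12 KA]]].
wlog A1z : A1 A2 cl1 cl2 A10 A20 A12 KA / A1 z.
  move=> wl; have : K z by exact: interior_subset.
  rewrite {1}KA => -[Az|Az]; first exact: (wl A1 A2).
  apply: (wl A2 A1) => //; last by rewrite setUC.
  by move=> x A2x A1x; exact: A12 A1x A2x.
have [E0 sE0 E0A2] := split_s _ _ cl1 cl2 A20 A12 KA A1z.
pose t := [seq E <- s | `[< E `&` A2 = set0 >]].
have tn : (size t < n)%N.
  rewrite size_filter -ltnS (leq_trans _ sn)// ltnS.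
  rewrite -(count_predC (fun E : set X => `[< E `&` A2 = set0 >]) s).
  rewrite -[X in (X < _)%N]addn0 ltn_add2l -has_count; apply/hasP; exists E0 => //=.
  by apply/asboolPn => /eqP; exact/negP/set0P.
have tE E : E \in t -> E \in s /\ E `&` A2 = set0.
  by rewrite mem_filter => /andP[/asboolP].
have [//|//||||W [cW Wz WA1]] := IHn A1 t.
- apply: filterS (filterI Kz (open_nbhs_nbhs (conj (closed_openC cl2) (A12 _ A1z)))).
  by move=> x []; rewrite {1}KA => -[].
- move=> E /tE[/sK[cE EK] EA2]; split=> // x Ex.
  have := EK _ Ex; rewrite {1}KA => -[//|A2x].
  by have : set0 x by rewrite -EA2.
- move=> H1 H2 clH1 clH2 H20 H12 A1H H1z.
  have H2A2 : H2 `<=` ~` A2 by move=> x H2x; apply: A12; rewrite A1H; right.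
  (* Adding [A2] to the side of [z] turns a splitting of [A1] into one of [K]. A connected [E]
     meeting [H2] then lies in [H2], so it misses [A2] and belongs to [t]. *)
  have [|//|//||||E sE EH2] := split_s (H1 `|` A2) H2.
  + exact: closedU.
  + move=> x [/H12//|A2x] H2x; exact: H2A2 H2x A2x.
  + by rewrite KA A1H setUAC.
  + by left.
  exists E => //; rewrite mem_filter sE andbT; apply/asboolP.
  have [cE EK] := sK _ sE.
  have EH : E `<=` H2.
    apply: (connected_sub_closed cE clH2 (closedU clH1 cl2)) => //.
    - by rewrite KA A1H (setUC H1) -setUA in EK.
    - move=> x [_ H2x] [H1x|A2x]; [exact: H12 H1x H2x|exact: H2A2 H2x A2x].
  by apply/seteqP; split=> // x [/EH/H2A2 + A2x] => /(_ A2x).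
- by exists W; split=> // x /WA1 A1x; rewrite KA; left.
Qed.

(* The intersection of the relatively clopen subsets of [K] containing [U] is
   connected: by compactness a splitting of it would extend to one of [K]. *)
Lemma split_or_continuum {K U} : closed K -> U !=set0 -> U `<=` K ->
  (exists Q1 Q2, [/\ closed Q1 /\ closed Q2, Q1 `<=` ~` Q2, K = Q1 `|` Q2,
     Q1 `&` U !=set0 & Q2 `&` U !=set0]) \/
  (exists D, [/\ continuum D, U `<=` D & D `<=` K]).
Proof.
move=> clK [u Uu] UK; apply: contrapT => /not_orP[nQ]; apply.
have onesided Q1 Q2 : closed Q1 -> closed Q2 -> Q1 `<=` ~` Q2 ->
    K = Q1 `|` Q2 -> Q1 u -> U `<=` Q1.
  move=> cl1 cl2 Q12 KQ Q1u x Ux; apply: contrapT => Q1x; apply: nQ.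
  exists Q1, Q2; split=> //; first by exists u.
  by exists x; split=> //; have := UK _ Ux; rewrite {1}KQ => -[].
pose P := [set H | [/\ closed H, U `<=` H &
  exists2 H', closed H' & H `<=` ~` H' /\ K = H `|` H']].
have PK : P K.
  split=> //; exists set0; first exact: closed0.
  by rewrite setU0; split=> // x _ [].
have PI A B : P A -> P B -> P (A `&` B).
  move=> [clA UA [A' clA' [AA' KA]]] [clB UB [B' clB' [BB' KB]]].
  split; [exact: closedI|by move=> x Ux; split; [exact: UA|exact: UB]|].
  exists (A' `|` B'); first exact: closedU.
  split=> [x [/AA' nA' /BB' nB'] [|]//|].
  apply/seteqP; split=> x; last first.
    by rewrite {1}KA => -[[Ax _]|[A'x|B'x]]; [left|right|rewrite -KA KB; right].
  move=> Kx; have := Kx; rewrite {1}KA => -[Ax|]; last by right; left.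
  by move: Kx; rewrite {1}KB => -[Bx|]; [left|right; right].
pose D := \bigcap_(H in P) H.
have clD : closed D by apply: closed_bigI => H [].
have DK : D `<=` K by move=> x /(_ _ PK).
have UD : U `<=` D by move=> x Ux H [_ UH _]; exact: UH.
exists D; split=> //; split; [exact: closed_compact| |by exists u; exact: UD].
apply: contrapT => /(not_connected_split clD)[A1 [A2 [[cl1 cl2] [A10 A20] A12 DA]]].
wlog A1u : A1 A2 cl1 cl2 A10 A20 A12 DA / A1 u.
  move=> wl; have := UD _ Uu; rewrite {1}DA => -[?|?]; first exact: (wl A1 A2).
  apply: (wl A2 A1) => //; last by rewrite setUC.
  by move=> x A2x A1x; exact: A12 A1x A2x.
have [V [oV A1V VA2]] := closed_separation cl1 cl2 A12.
have [||||B [A PA AB] KVB] := @compact_covering_ind _ (K `&` (closure V `&` ~` V))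
    (fun B => exists2 A, P A & A `<=` ~` B).
- apply: closed_compact; apply: closedI => //.
  by apply: closedI; [exact: closed_closure|exact: open_closedC].
- by exists K => // x _ [].
- move=> B B' [A PA AB] [A' PA' AB']; exists (A `&` A'); first exact: PI.
  by move=> x [/AB ? /AB' ?] [].
- move=> x [_ [clVx Vx]].
  have : ~ D x by rewrite DA => -[/A1V//|]; exact: VA2.
  move=> /existsNP[A /not_implyP[PA Ax]]; exists (~` A); last first.
    by exists A => // y ? [].
  apply: open_nbhs_nbhs; split=> //; apply: closed_openC; by case: PA.
have [clA UA [A' clA' [AA' KA]]] := PA.
have AK x : A x -> K x by rewrite KA; left.
have AV x : A x -> closure V x -> V x.
  move=> Ax Vx; apply: contrapT => nVx; apply: (AB _ Ax); apply: KVB.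
  by split; [exact: AK|].
(* Since [A] misses the boundary of [V], cutting [A] along that boundary gives a smaller member [H]
   of [P], which no longer meets [A2]. *)
pose H := closure V `&` A; pose H' := A' `|` (A `&` ~` V).
have clH : closed H by apply: closedI => //; exact: closed_closure.
have clH' : closed H'.
  by apply: closedU => //; apply: closedI => //; exact: open_closedC.
have HH' : H `<=` ~` H' by move=> y [Vy Ay] [|[_]]; [exact: AA'|apply; exact: AV].
have KH : K = H `|` H'.
  apply/seteqP; split=> y.
    rewrite {1}KA => -[Ay|]; last by right; left.
    have [Vy|] := pselect (V y); last by right; right.
    by left; split=> //; exact: subset_closure.
  by rewrite KA => -[[_]|[|[]]]; [left|right|left].
have DH : D `<=` H.
  apply: bigcap_inf; split=> //; last by exists H'.
  by apply: (@onesided _ H') => //; split; [exact/subset_closure/A1V|exact: UA].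
have [x A2x] := A20.
by have [/VA2 /(_ A2x)] : H x by apply: DH; rewrite DA; right.
Qed.

End metric_continuum.

(** * The set function T without continuity *)

Section jones.
Context {R : realType} {X : metricType R} (cX : continuum [set: X]).
Implicit Types (A B C E F P Q S V W : set X) (p u x y z : X).

Lemma jonesPn {A x} : ~ jones A x ->
  exists W, [/\ continuum W, W° x & W `<=` ~` A].
Proof. exact: contrapT. Qed.

Lemma jones_meet {A x W} : jones A x -> continuum W -> W° x -> W `&` A !=set0.
Proof.
move=> TAx cW Wx; apply: contrapT => WA; apply: TAx; exists W; split=> //.
by move=> y Wy Ay; apply: WA; exists y.
Qed.

Lemma jones_subset {A B} : A `<=` B -> jones A `<=` jones B.
Proof.
move=> AB x TAx [W [cW Wx WB]]; apply: TAx; exists W; split=> //.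
by move=> y /WB By /AB.
Qed.

Lemma jones0 : jones (set0 : set X) = set0.
Proof.
apply/seteqP; split=> // x /jones_meet /(_ cX)[].
  by rewrite interiorT.
by move=> y [].
Qed.

(** By [subset_jones] these are the fixed sets of T. The empty set, absent from the hyperspace, is
    allowed and serves as the bottom fixed set. *)
Definition jones_closed C := jones C `<=` C.

Lemma jones_closed_closed {C} : jones_closed C -> closed C.
Proof.
move=> TC; have -> : C = jones C by apply/seteqP; split=> //; exact: subset_jones.
exact: closed_jones.
Qed.

Lemma jones_sub {A C} : jones_closed C -> A `<=` C -> jones A `<=` C.
Proof. by move=> TC AC x /(jones_subset AC)/TC. Qed.

(* The boundary of a neighbourhood [V] of [P] is covered by finitely many continua
   missing [A]; cutting [W] along it leaves a neighbourhood of [z] with finitely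
   many components. *)
Lemma jones_separated {A P Q} : closed P -> closed Q -> P `<=` ~` Q ->
  jones A `<=` P `|` Q -> jones A `&` P `<=` jones (A `&` P).
Proof.
move=> clP clQ PQ TA z [TAz Pz]; apply: contrapT => /jonesPn[W [cW Wz WAP]].
have [V [oV PV VQ]] := closed_separation cX clP clQ PQ.
have clW := continuum_closed cW.
have AV x : A x -> closure V x -> P x.
  by move=> /subset_jones /TA[//|] Qx /VQ /(_ Qx).
pose N (B : set X) := exists2 s : seq (set X),
  (forall E, E \in s -> [/\ connected E, closed E & E `<=` ~` A]) &
  B `<=` [set x | exists2 E, E \in s & E x].
have [||||B [s sA Bs] VB] := @compact_covering_ind _ (closure V `&` ~` V) N.
- apply: (closed_compact cX); apply: closedI; first exact: closed_closure.
  exact: open_closedC.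
- by exists [::].
- move=> B B' [s sA Bs] [s' sA' Bs']; exists (s ++ s').
    by move=> E; rewrite mem_cat => /orP[/sA|/sA'].
  move=> x [/Bs[E sE Ex]|/Bs'[E sE Ex]]; exists E => //; rewrite mem_cat sE//.
  by rewrite orbT.
- move=> x [clVx Vx].
  have /jonesPn[W' [cW' W'x W'A]] : ~ jones A x.
    by move=> /TA[/PV//|Qx]; exact: VQ clVx Qx.
  exists W' => //; exists [:: W'].
    move=> E; rewrite inE => /eqP ->; split=> //; last exact: continuum_closed.
    by case: cW'.
  by move=> y W'y; exists W' => //; rewrite inE.
have cls : closed [set x | exists2 E, E \in s & E x].
  elim: s sA {Bs} => [_|E s IH sA].
    by rewrite (_ : [set _ | _] = set0); [exact: closed0|apply/seteqP; split=> // x []].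
  rewrite (_ : [set _ | _] = E `|` [set x | exists2 E, E \in s & E x]).
    apply: closedU; first by have [|] := sA E; rewrite ?inE ?eqxx.
    by apply: IH => F sF; apply: sA; rewrite inE sF orbT.
  apply/seteqP; split=> x.
    by move=> [F]; rewrite inE => /orP[/eqP ->|sF Fx]; [left|right; exists F].
  by move=> [Ex|[F sF Fx]]; [exists E|exists F] => //; rewrite inE ?eqxx ?sF ?orbT.
set L := [set x | _] in Bs cls.
have VL x : closure V x -> ~ V x -> L x by move=> ? ?; exact/Bs/VB.
have Vz : V z by exact: PV.
have [WV|] := pselect (W `<=` V).
  apply: TAz; exists W; split=> // x Wx Ax; apply: (WAP _ Wx); split=> //.
  by apply: AV => //; apply: subset_closure; exact: WV.
move=> /existsNP[w /not_implyP[Ww Vw]].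
pose K := (W `&` closure V) `|` L.
have clK : closed K.
  by apply: closedU => //; apply: closedI => //; exact: closed_closure.
have [||E sE|H1 H2 cl1 cl2 H20 H12 KH H1z|W' [cW' W'z W'K]] :=
    @continuum_nbhs _ _ cX K z s => //.
- apply: filterS (filterI Wz (open_nbhs_nbhs (conj oV Vz))) => x [Wx Vx].
  by left; split=> //; exact: subset_closure.
- have [cE _ _] := sA _ sE; split=> // x Ex; right; exists E => //.
(* If [H2] missed [L], it would lie in [W] and in [V]. Then [H2] and the union of [H1] with the
   complement of [V] would split [W], forcing [W] into [H2] although [z] is in [H1]. *)
- apply: contrapT => nE.
  have H2s x : H2 x -> ~ L x.
    by move=> H2x [E sE Ex]; apply: nE; exists E => //; exists x.
  have H2V x : H2 x -> V x.
    move=> H2x; apply: contrapT => Vx.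
    have : K x by rewrite KH; right.
    by case=> [[_ clVx]|]; [apply: (H2s _ H2x); exact: VL|exact: H2s].
  have H2W x : H2 x -> W x.
    move=> H2x; have : K x by rewrite KH; right.
    by case=> [[]//|/(H2s _ H2x)].
  have [x H2x] := H20.
  have WH2 : W `<=` H2.
    have [_ cW' _] := cW.
    apply: (connected_sub_closed cW' cl2 (closedU cl1 (open_closedC oV))).
    + move=> y Wy; have [Vy|] := pselect (V y); last by right; right.
      have : K y by left; split=> //; exact: subset_closure.
      by rewrite KH => -[]; [right; left|left].
    + by move=> y [_ H2y] [/H12/(_ H2y)//|]; apply; exact: H2V.
    + by exists x; split=> //; exact: H2W.
  by apply: (H12 _ H1z); apply: WH2; exact: interior_subset.
- apply: TAz; exists W'; split=> // x /W'K[[Wx clVx] Ax|[E sE Ex]].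
    by apply: (WAP _ Wx); split=> //; exact: AV.
  by have [_ _] := sA _ sE; exact.
Qed.

(** Upper semicontinuity: a continuum witnessing that [y] is outside T(C U {x}) still works for all
    nearby [y'] and [x']; compactness of [E] makes this uniform in [y]. *)
Lemma closed_jones_meet C E : closed E ->
  closed [set x | jones (C `|` [set x]) `&` E !=set0].
Proof.
move=> clE; rewrite -[X in closed X]setCK; apply: open_closedC.
rewrite openE => x /= nx; rewrite /interior.
have /compact_near_coveringP cE := closed_compact cX clE.
suff : \forall x' \near x, E `<=` [set y | ~ jones (C `|` [set x']) y].
  by apply: filterS => x' Ex' [y [Ty /Ex']].
apply: cE => y Ey.
have /jonesPn[W [cW Wy WCx]] : ~ jones (C `|` [set x]) y.
  by move=> Ty; apply: nx; exists y.
exists (W°, ~` W) => /=.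
  split; first exact: nbhs_interior.
  apply: open_nbhs_nbhs; split.
    by apply: closed_openC; exact: continuum_closed cW.
  by move=> /WCx; apply; right.
move=> [y' x'] /= [Wy' Wx']; apply; exists W; split=> // w Ww [Cw|wx].
  by apply: WCx Ww _; left.
by apply: Wx'; rewrite -wx.
Qed.

Lemma interior_meet_jones_sub {p W} : continuum W -> W° `&` jones [set p] !=set0 ->
  W p.
Proof. by move=> cW [u [Wu /jones_meet /(_ cW Wu)[q [Wq <-]]]]. Qed.

Lemma nbhs_ball_center {x s : X} {d : R} : ball x d s -> nbhs x (ball s d).
Proof.
rewrite ballEmdist /= => xs; apply/nbhs_ballP; exists (d - mdist x s) => /=.
  by rewrite subr_gt0.
move=> y; rewrite !ballEmdist /= => xy.
by rewrite (le_lt_trans (metric_triangle s x y))// metric_sym -ltrBrDl.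
Qed.

Lemma closed_approx S {d : R} : 0 < d ->
  exists F, [/\ closed F, F `<=` S & closure S `<=` set_ball F d].
Proof.
move=> d0.
have [||||B [F [clF FS BF]] SB] := @compact_covering_ind _ (closure S)
  (fun B => exists F, [/\ closed F, F `<=` S & B `<=` set_ball F d]).
- by apply: (closed_compact cX); exact: closed_closure.
- by exists set0; split=> //; exact: closed0.
- move=> A B [F [clF FS AF]] [F' [clF' FS' BF']]; exists (F `|` F'); split.
  + exact: closedU.
  + by move=> x [/FS|/FS'].
  + by move=> x [/AF[y Fy yx]|/BF'[y Fy yx]]; exists y => //; [left|right].
- move=> x /(_ _ (nbhsx_ballx x d d0))[s [Ss xs]].
  exists (ball s d); first exact: nbhs_ball_center.
  exists [set s]; split; last by move=> y; rewrite ballEmdist => sy; exists s.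
    exact: metric_closed1.
  by move=> y ->.
by exists F; split=> //; exact: subset_trans BF.
Qed.

(** * Consequences of the continuity of T *)

Section continuous_jones.
Context (Tcont : continuous (@jones_hyperspace R X cX)).

Lemma jones_lsc {A V} : closed A -> A !=set0 -> open V -> jones A `&` V !=set0 ->
  exists2 d : R, 0 < d & forall B, closed B -> B !=set0 ->
    A `<=` set_ball B d -> B `<=` set_ball A d -> jones B `&` V !=set0.
Proof.
move=> clA A0 oV [y [TAy Vy]].
have /nbhs_ballP[e /= e0 yV] : nbhs y V by exact: open_nbhs_nbhs.
pose hA := Hyperspace cX clA A0.
have /nbhs_ballP[d /= d0 dT] := Tcont hA _ (nbhsx_ballx (jones_hyperspace hA) e e0).
have d20 : 0 < d / 2 by rewrite divr_gt0.
(* Halving turns the weak bound of [hausdorff_dist_le] into the strict one required by the ball. *)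
exists (d / 2) => // B clB B0 AB BA; pose hB := Hyperspace cX clB B0.
have /dT /= : ball hA d hB.
  rewrite ballEmdist /=.
  apply: (@le_lt_trans _ _ (d / 2)); last by rewrite gtr_pMr// invf_lt1 ?ltr1n.
  exact: (@hausdorff_dist_le _ _ cX hA hB).
rewrite ballEmdist /= => TAB.
have [|e' [_ TAB' _]] := @hausdorff_dist_adherent _ _ cX (jones_hyperspace hA)
    (jones_hyperspace hB) (e - mdist (jones_hyperspace hA) (jones_hyperspace hB)).
  by rewrite subr_gt0.
rewrite [X in _ < X]addrC subrK => e'e.
have [b TBb by_] := TAB' _ TAy; exists b; split=> //; apply: yV.
by rewrite ballEmdist /= metric_sym (lt_trans by_).
Qed.

(** Lower semicontinuity, the counterpart of [closed_jones_meet]: a condition on [x] expressible in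
    both forms is clopen, hence constant on X. *)
Lemma open_jones_meet C V : closed C -> open V ->
  open [set x | jones (C `|` [set x]) `&` V !=set0].
Proof.
move=> clC oV; rewrite openE => x /= xV; rewrite /interior.
have [||d d0 dV] := jones_lsc _ _ oV xV; [|by exists x; right|].
  by apply: closedU => //; exact: metric_closed1.
apply/nbhs_ballP; exists d => // y; rewrite ballEmdist /= => xy; apply: dV.
- by apply: closedU => //; exact: metric_closed1.
- by exists y; right.
- move=> z [Cz|->]; first by exists z; [left|rewrite mdistxx].
  by exists y; [right|rewrite metric_sym].
- move=> z [Cz|->]; first by exists z; [left|rewrite mdistxx].
  by exists x; [right|].
Qed.

(* Approximate [~` W°] by closed subsets of [~` W], whose images under
   [jones] miss [W°]. *)
Lemma jones_closed_interiorC {W} : continuum W -> jones_closed (~` W°).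
Proof.
move=> cW x Tx Wx; have := Tx => /jones_meet /(_ cW Wx)[c [_ Wc]].
have clWc : closed (~` W°) by apply: open_closedC; exact: open_interior.
have [||d d0 dW] := jones_lsc clWc _ (@open_interior _ W); [by exists c|by exists x|].
have [F [clF FW WF]] := closed_approx (~` W) d0.
have WcE : closure (~` W) = ~` W°.
  by rewrite -[LHS]setCK -interiorC setCK.
rewrite WcE in WF.
have [||||y [TFy Wy]] := dW F => //.
- by have [f Ff _] := WF _ Wc; exists f.
- by move=> f /FW Wf; exists f; [move=> /interior_subset|rewrite mdistxx].
- by have [z [Wz /FW]] := jones_meet TFy cW Wy.
Qed.

Lemma jones_shrink {W x} : continuum W -> W° x ->
  exists V, [/\ continuum V, V° x & V `<=` W°].
Proof.
move=> cW Wx; have /jonesPn[V [cV Vx VW]] : ~ jones (~` W°) x.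
  by move=> /(jones_closed_interiorC cW).
by exists V; split=> // y /VW /contrapT.
Qed.

(** A continuum [W] missing [A] keeps T(A) inside the fixed set X \ W°, so T(T(A)) stays there
    too. *)
Lemma jones_closed_jones A : jones_closed (jones A).
Proof.
move=> x TTx; apply: contrapT => /jonesPn[W [cW Wx WA]].
suff : (~` W°) x by exact.
apply: (jones_closed_interiorC cW); apply: jones_subset TTx => y TAy Wy.
by have [z [/WA]] := jones_meet TAy cW Wy.
Qed.

(** By compactness some member of the chain is Hausdorff-close to the closure [K]. If T(K) left [K],
    lower semicontinuity would make the image of that member leave [K] as well. *)
Lemma jones_closed_chain (F : set (set X)) : F !=set0 ->
  total_on F (fun A B => A `<=` B) -> (forall A, F A -> jones_closed A) ->
  jones_closed (closure (\bigcup_(A in F) A)).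
Proof.
move=> [A0 FA0] Ftot FT x; set K := closure _ => TKx; apply: contrapT => Kx.
have [|k [_ Kk]] := jones_meet TKx cX; first by rewrite interiorT.
have clK : closed K by exact: closed_closure.
have [||d d0 dK] := jones_lsc clK _ (closed_openC clK); [by exists k|by exists x|].
have [||||B [A FA BA] KB] := @compact_covering_ind _ K
  (fun B => exists2 A, F A & B `<=` set_ball A d).
- exact: (closed_compact cX clK).
- by exists A0.
- move=> B B' [A FA BA] [A' FA' BA'].
  have [AA'|AA'] := Ftot _ _ FA FA'.
    by exists A' => // y [/BA[a /AA' A'a ay]|/BA'//]; exists a.
  by exists A => // y [/BA//|/BA'[a /AA' Aa ay]]; exists a.
- move=> y /(_ _ (nbhsx_ballx y d d0))[s [[A FA As] ys]].
  exists (ball s d); first exact: nbhs_ball_center.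
  by exists A => // z; rewrite ballEmdist => sz; exists s.
have AK : A `<=` K by move=> y Ay; apply: subset_closure; exists A.
have clA := jones_closed_closed (FT _ FA).
have [||||y [TAy]] := dK A => //.
- by have [a Aa _] := BA _ (KB _ Kk); exists a.
- exact: subset_trans BA.
- by move=> y Ay; exists y; [exact: AK|rewrite mdistxx].
- by apply; apply: AK; exact: FT TAy.
Qed.

Lemma ex_maximal_jones_closed {C E} : closed E -> jones_closed C -> C `<=` E ->
  exists G, [/\ jones_closed G, C `<=` G, G `<=` E & forall G', jones_closed G' ->
    G `<=` G' -> G' `<=` E -> G' `<=` G].
Proof.
move=> clE TC CE.
pose J G := [/\ jones_closed G, C `<=` G & G `<=` E].
have JC : [/\ jones_closed C, C `<=` C & C `<=` E] by split.
have [||A Atot|[G [TG CG GE]] Gmax] :=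
  @ZL_preorder {G | J G} (exist J C JC) (fun s t => `[< sval s `<=` sval t >]).
- by move=> t; apply/asboolP.
- by move=> r s t /asboolP rs /asboolP st; apply/asboolP; exact: subset_trans st.
- have [[a Aa]|A0] := pselect (A !=set0); last first.
    by exists (exist J C JC) => s As; exfalso; apply: A0; exists s.
  pose F := [set sval s | s in A].
  have JF : J (closure (\bigcup_(B in F) B)).
    split.
    + apply: jones_closed_chain.
      * by exists (sval a); exists a.
      * move=> _ _ [s As <-] [t At <-].
        by have [/asboolP|/asboolP] := Atot _ _ As At; [left|right].
      * by move=> _ [[G [TG CG GE]] _ <-].
    + move=> x Cx; apply: subset_closure; exists (sval a); first by exists a.
      by case: (svalP a) => _ + _; apply.
    + rewrite (closure_id E).1//; apply: closure_subset => x [_ [s _ <-]].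
      by case: (svalP s) => _ _; apply.
  exists (exist J _ JF) => s As; apply/asboolP => x sx /=.
  by apply: subset_closure; exists (sval s) => //; exists s.
- exists G; split=> // G' TG' GG' G'E.
  have JG' : J G'.
    by split=> //; exact: subset_trans GG'.
  by have /asboolP := Gmax (exist J G' JG') (introT (asboolP _) GG').
Qed.

End continuous_jones.
End jones.

(** * Minimal points of the preorder in which y lies below x when y is in T({x}) *)

Definition jones_minimal {R : realType} {X : metricType R} : set X :=
  [set x | forall y, jones [set x] y -> jones [set y] x].

Section minimal_points.
Context {R : realType} {X : metricType R} (cX : continuum [set: X]).
Context (Tcont : continuous (@jones_hyperspace R X cX)).
Implicit Types (A C E F N Q U V W : set X) (p x y z : X).

Lemma jones_sub_jones {A C} : A `<=` jones C -> jones A `<=` jones C.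
Proof. exact: jones_sub (jones_closed_jones cX Tcont C). Qed.

Lemma jones_sub1 {C x} : jones C x -> jones [set x] `<=` jones C.
Proof. by move=> Cx; apply: jones_sub_jones => y ->. Qed.

Lemma jones_minimal_sub {x} : jones_minimal x -> jones [set x] `<=` jones_minimal.
Proof.
by move=> Mx y xy z yz; exact: (jones_sub1 (Mx z (jones_sub1 xy _ yz)) _ xy).
Qed.

(** If [W] is a neighbourhood of [x] missing some [y] in T({x}), lower semicontinuity gives a
    minimal [z] in W° with a point [w] of T({z}) outside [W]. Minimality puts [z] in T({w}), so [W]
    must contain [w]. *)
Lemma closed_jones_minimal : closed (jones_minimal : set X).
Proof.
move=> x clx y xy; apply: contrapT => /jonesPn[W [cW Wx Wy]].
have oW : open (~` W) by apply: closed_openC; exact: continuum_closed cW.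
have oN := open_jones_meet cX Tcont set0 (~` W) closed0 oW.
have Nx : nbhs x [set x | jones (set0 `|` [set x]) `&` ~` W !=set0].
  apply: open_nbhs_nbhs; split=> //; exists y; rewrite set0U; split=> // Wy'.
  exact: Wy Wy' _.
have [z [Mz [[w [zw Ww]] Wz]]] := clx _ (filterI Nx (nbhs_interior Wx)).
rewrite set0U in zw; apply: Ww.
have [w' [Ww' w'w]] := jones_meet (Mz _ zw) cW (Wz); by rewrite -w'w.
Qed.

Lemma ex_jones_minimal z : exists2 m, jones [set z] m & jones_minimal m.
Proof.
have zz : jones [set z] z by exact: subset_jones.
have [||A Atot|[m zm] mmax] := @ZL_preorder {x | jones [set z] x}
    (exist (jones [set z]) z zz) (fun s t => `[< jones [set sval s] (sval t) >]).
- by move=> t; apply/asboolP; exact: subset_jones.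
- move=> r s t /asboolP rs /asboolP st; apply/asboolP.
  exact: (jones_sub1 rs _ st).
- have [[a Aa]|A0] := pselect (A !=set0); last first.
    by exists (exist (jones [set z]) z zz) => s As; exfalso; apply: A0; exists s.
  (* A lower bound of the chain is a common point of the nested closed sets T({s}), found by
     compactness. *)
  suff [t tA] : exists t, forall s, A s -> jones [set sval s] t.
    have zt : jones [set z] t by apply: (jones_sub1 (svalP a)); exact: tA.
    by exists (exist (jones [set z]) t zt) => s As; apply/asboolP; exact: tA.
  apply: contrapT => nt.
  have [cT _ _] := cX.
  have [||x _|B [s As Bs] TB] := @compact_covering_ind _ setT
    (fun B => exists2 s, A s & B `<=` ~` jones [set sval s]) cT.
  + by exists a.
  + move=> B B' [s As Bs] [t At Bt].
    have [/asboolP st|/asboolP ts] := Atot _ _ As At.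
      exists t => // x [/Bs sx tx|/Bt//]; apply: sx; exact: (jones_sub1 st).
    exists s => // x [/Bs//|/Bt tx sx]; apply: tx; exact: (jones_sub1 ts).
  + have /existsNP[s /not_implyP[As sx]] : ~ forall s, A s -> jones [set sval s] x.
      by move=> xA; apply: nt; exists x.
    exists (~` jones [set sval s]); last by exists s.
    apply: open_nbhs_nbhs; split=> //; apply: closed_openC; exact: closed_jones.
  + by apply: (Bs (sval s)) (TB _ I) _; exact: subset_jones.
- exists m => // y my.
  have zy : jones [set z] y by exact: (jones_sub1 zm).
  by have /asboolP := mmax (exist (jones [set z]) y zy) (introT (asboolP _) my).
Qed.

End minimal_points.

(** * Enlarging fixed sets when T({p}) contains an open set U *)

Section fat_image.
Context {R : realType} {X : metricType R} (cX : continuum [set: X]).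
Context (Tcont : continuous (@jones_hyperspace R X cX)).
Context {p : X} {U : set X} (oU : open U)
  (Up : U `<=` jones [set p]).
Implicit Types (C N Q W : set X) (x y z : X).

(** Membership of [p] is automatic; applying it to a continuum shrunk into W° upgrades it to
    interior membership. *)
Lemma interior_meet_mem {W} : continuum W -> W° `&` U !=set0 -> W° p.
Proof.
move=> cW [u [Wu Uu]]; have [V [cV Vu VW]] := jones_shrink cX Tcont cW Wu.
by apply: VW; apply: (interior_meet_jones_sub cV); exists u; split=> //; exact: Up.
Qed.

(* Otherwise [p] is in [jones (C `|` [set x])] exactly when
   [jones (C `|` [set x])] meets [U `&` ~` C], which is a clopen condition. *)
Lemma ex_continuum_nsubset {C x} : jones_closed C -> ~ U `<=` C ->
  ~ jones (C `|` [set x]) p ->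
  exists W, [/\ continuum W, W° p, W `<=` ~` C & ~ U `<=` C `|` W].
Proof.
move=> TC UC xp; apply: contrapT => nW.
have clC := jones_closed_closed TC.
have oUC : open (U `&` ~` C) by apply: openI => //; exact: closed_openC.
have Tp u : (U `&` ~` C) u -> jones (C `|` [set u]) p.
  move=> [Uu Cu]; apply: contrapT => /jonesPn[W [cW Wp WCu]].
  apply: nW; exists W; split=> //; first by move=> y /WCu + Cy; apply; left.
  by move=> /(_ _ Uu)[//|/WCu]; apply; right.
pose L := [set x | jones (C `|` [set x]) `&` [set p] !=set0].
have LE : L = [set x | jones (C `|` [set x]) `&` (U `&` ~` C) !=set0].
  apply/seteqP; split=> y [q [yq]].
    move=> qp; rewrite {}qp in yq.
    have /existsNP[u /not_implyP[Uu Cu]] := UC.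
    by exists u; split=> //; exact: (jones_sub1 cX Tcont yq _ (Up _ Uu)).
  move=> UCq; exists p; split=> //.
  apply: (jones_sub_jones cX Tcont _ _ (Tp _ UCq)).
  by move=> w [Cw|->//]; apply: subset_jones; left.
have LT : L = setT.
  apply: (clopenT_full cX).
  - by rewrite LE; apply: (open_jones_meet cX Tcont).
  - by apply: (closed_jones_meet cX); exact: metric_closed1.
  - by exists p, p; split=> //; apply: subset_jones; right.
have [q [xq qp]] : L x by rewrite LT.
by apply: xp; rewrite -qp.
Qed.

(* Otherwise [~` W°] splits into closed sets [Q1] and [Q2], and the set of the
   points [x] such that [jones (C `|` [set x])] meets both [Q1 `&` W] and
   [Q2 `&` W] is clopen, contains [p] and lies in [W°]. *)
Lemma ex_jones_sub_continuum {C W} : jones_closed C -> continuum W -> W° p ->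
  W `<=` ~` C -> ~ U `<=` C `|` W ->
  exists2 z, W z & jones (C `|` [set z]) `<=` C `|` W.
Proof.
move=> TC cW Wp WC UCW; apply: contrapT => nz.
have clC := jones_closed_closed TC.
have clW := continuum_closed cW.
have escape z : W z -> exists2 v, jones (C `|` [set z]) v & ~ (C `|` W) v.
  move=> Wz; apply: contrapT => nv; apply: nz; exists z => // v zv.
  by apply: contrapT => CWv; apply: nv; exists v.
pose K := ~` W°.
have TK : jones_closed K := jones_closed_interiorC cX Tcont cW.
have clK : closed K := jones_closed_closed TK.
have CK : C `<=` K by move=> x Cx /interior_subset /WC; exact.
have WK x : ~ W x -> K x by move=> Wx /interior_subset.
have CWK x : ~ (C `|` W) x -> K x by move=> CWx; apply: WK => Wx; apply: CWx; right.
pose V := U `&` ~` (C `|` W).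
have oCW : open (~` (C `|` W)) by apply: closed_openC; exact: closedU.
have V0 : V !=set0.
  by have /existsNP[u /not_implyP[Uu CWu]] := UCW; exists u.
have [|[Q1 [Q2 [[cl1 cl2] Q12 KQ [u1 [Q1u1 [Uu1 CWu1]]] [u2 [Q2u2 [Uu2 CWu2]]]]]]|
    [D [cD VD DK]]] := split_or_continuum cX clK V0.
- by move=> x [_ /CWK].
(* For [x] in [Q'], T(C U {x}) lies in [K], and its part in [Q] depends only on the part of [C] in
   [Q], by [jones_separated]. *)
- have sub_jones Q Q' x : closed Q -> closed Q' -> Q `<=` ~` Q' -> K = Q `|` Q' ->
      Q' x -> jones (C `|` [set x]) `&` Q `<=` C.
    move=> clQ clQ' QQ' KE Q'x y xy; apply: TC.
    apply: (jones_subset _ _ (jones_separated cX clQ clQ' QQ' _ _ xy)).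
      by move=> w [[//|->] Qx]; case: (QQ' _ Qx).
    rewrite -KE; apply: jones_sub => // w [/CK//|->]; rewrite KE; by right.
  (* A point [z] of T(C U {x}) in [Q] and [W] has an escape point [v], which [sub_jones] keeps out
     of [Q']. *)
  have meet_out Q Q' x : closed Q -> closed Q' -> Q `<=` ~` Q' -> K = Q `|` Q' ->
      jones (C `|` [set x]) `&` (Q `&` W) !=set0 ->
      jones (C `|` [set x]) `&` (Q `&` ~` (C `|` W)) !=set0.
    move=> clQ clQ' QQ' KE [z [xz [Qz Wz]]].
    have [v zv CWv] := escape _ Wz.
    exists v; split; last split=> //.
      apply: (jones_sub_jones cX Tcont _ _ zv) => w [Cw|->//].
      by apply: subset_jones; left.
    have := CWK _ CWv; rewrite KE => -[//|Q'v]; exfalso; apply: CWv; left.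
    apply: (sub_jones Q' Q z) => //; last by rewrite setUC.
    by move=> w Q'w Qw; exact: QQ' Qw Q'w.
  (* If T(C U {x}) missed the part of [Q] in [W], its part in [Q] would be separated from the rest.
     As [x] is not in [Q], that part would then lie in [C]. *)
  have meet_in Q Q' x : closed Q -> closed Q' -> Q `<=` ~` Q' -> K = Q `|` Q' ->
      W° x -> jones (C `|` [set x]) `&` (Q `&` ~` (C `|` W)) !=set0 ->
      jones (C `|` [set x]) `&` (Q `&` W) !=set0.
    move=> clQ clQ' QQ' KE Wx [v [xv [Qv CWv]]]; apply: contrapT => xQW.
    have clJ := @closed_jones _ _ (C `|` [set x]).
    apply: CWv; left; apply: TC.
    apply: (jones_subset _ _ (jones_separated cX (closedI clJ clQ)
      (closedI clJ (closedU clQ' clW)) _ _ _ (conj xv (conj xv Qv)))).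
    + move=> w [[//|->] [_ Qx]].
      by have : K x by rewrite KE; left.
    + move=> w [xw Qw] [_ [Q'w|Ww]]; first exact: QQ' Qw Q'w.
      by apply: xQW; exists w.
    + move=> w xw; have [Ww|/WK] := pselect (W w); first by right; split=> //; right.
      by rewrite KE => -[Qw|Q'w]; [left|right; split=> //; left].
  have Q21 : Q2 `<=` ~` Q1 by move=> w Q2w Q1w; exact: Q12 Q1w Q2w.
  have KQ' : K = Q2 `|` Q1 by rewrite setUC.
  have oQ Q Q' : closed Q' -> Q `<=` ~` Q' -> K = Q `|` Q' ->
      open (Q `&` ~` (C `|` W)).
    move=> clQ' QQ' KE; rewrite (_ : _ `&` _ = ~` Q' `&` ~` (C `|` W)).
      by apply: openI => //; exact: closed_openC.
    apply/seteqP; split=> w [Qw CWw]; split=> //; first exact: QQ'.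
    by have := CWK _ CWw; rewrite KE => -[].
  (* [S] is visibly closed and [S'] visibly open; their equality gives the clopen set. *)
  pose S := [set x | jones (C `|` [set x]) `&` (Q1 `&` W) !=set0] `&`
            [set x | jones (C `|` [set x]) `&` (Q2 `&` W) !=set0].
  pose S' := [set x | jones (C `|` [set x]) `&` (Q1 `&` ~` (C `|` W)) !=set0] `&`
             [set x | jones (C `|` [set x]) `&` (Q2 `&` ~` (C `|` W)) !=set0].
  have S'W x : S' x -> W° x.
    move=> [[v [xv [Q1v CWv]]] [w [xw [Q2w CWw]]]]; apply: contrapT => Kx.
    have : K x by [].
    rewrite KQ => -[Q1x|Q2x].
      by apply: CWw; left; apply: (sub_jones Q2 Q1 x).
    by apply: CWv; left; apply: (sub_jones Q1 Q2 x).
  have SE : S = S'.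
    apply/seteqP; split=> x.
      by move=> [S1 S2]; split; [exact: (meet_out _ Q2)|exact: (meet_out _ Q1)].
    move=> S'x; have [S1 S2] := S'x; have Wx := S'W _ S'x.
    by split; [exact: (meet_in _ Q2)|exact: (meet_in _ Q1)].
  have ST : S = setT.
    apply: (clopenT_full cX).
    + rewrite SE; apply: openI; apply: (open_jones_meet cX Tcont) => //.
        exact: (oQ _ Q2).
      exact: (oQ _ Q1).
    + by apply: closedI; apply: (closed_jones_meet cX); exact: closedI.
    + have Tp : jones [set p] `<=` jones (C `|` [set p]).
        by apply: jones_subset => w ->; right.
      exists p; rewrite SE; split; [exists u1|exists u2]; split=> //.
        exact/Tp/Up.
      exact/Tp/Up.
  have : W° u1 by apply: S'W; rewrite -SE ST.
  by move=> /interior_subset Wu1; apply: CWu1; right.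
(* Here [D] contains a nonempty open part of [U], hence [p], although it avoids W°. *)
- suff Dp : D p by exact: (DK _ Dp).
  apply: interior_subset; apply: (interior_meet_mem cD).
  have [u Vu] := V0; exists u; split; last by case: Vu.
  apply: filterS VD _; apply: open_nbhs_nbhs; split=> //; exact: openI.
Qed.

(** [N] is T({m}) for a minimal [m] below the point [z] of [ex_jones_sub_continuum]. As [C] and [W]
    are disjoint, [jones_separated] confines T(C U {m}) to the union of [C] and T({m}). *)
Lemma ex_jones_closedU {C W} : jones_closed C -> continuum W -> W° p ->
  W `<=` ~` C -> ~ U `<=` C `|` W ->
  exists N, [/\ N !=set0, N `<=` W, N `<=` jones_minimal & jones_closed (C `|` N)].
Proof.
move=> TC cW Wp WC UCW.
have [z Wz zCW] := ex_jones_sub_continuum TC cW Wp WC UCW.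
have clC := jones_closed_closed TC; have clW := continuum_closed cW.
have CW : C `<=` ~` W by move=> x Cx /WC; exact.
have WC' : jones (C `|` [set z]) `<=` W `|` C by rewrite (setUC W).
(* A point of T({z}) in [C] would lie in the image of the empty set, since [z] is not in [C]. *)
have zW : jones [set z] `<=` W.
  move=> x zx; have := zCW _ (jones_subset (@subsetUr _ C _) _ zx).
  case=> // Cx; suff : jones (set0 : set X) x by rewrite (jones0 cX).
  apply: (jones_subset _ _ (jones_separated cX clC clW CW _ _ (conj zx Cx))).
    by move=> w [-> /CW].
  by apply: subset_trans zCW; apply: jones_subset => w ->; right.
have [m zm Mm] := ex_jones_minimal cX Tcont z.
have Wm := zW _ zm.
have Tm : jones (C `|` [set m]) `<=` C `|` jones [set m].
  move=> x mx.
  have mCW : jones (C `|` [set m]) `<=` W `|` C.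
    apply: subset_trans WC'; apply: (jones_sub_jones cX Tcont) => w [Cw|->].
      by apply: subset_jones; left.
    by apply: (jones_subset _ _ zm) => v ->; right.
  have [Wx|Cx] := mCW _ mx; last by left.
  right; apply: (jones_subset _ _ (jones_separated cX clW clC WC mCW _ (conj mx Wx))).
  by move=> w [[/CW//|//]].
exists (jones [set m]); split.
- by exists m; exact: subset_jones.
- exact: subset_trans (jones_sub1 cX Tcont zm) zW.
- exact: (jones_minimal_sub cX Tcont Mm).
- move=> x Cmx; apply: Tm; apply: (jones_sub_jones cX Tcont _ _ Cmx) => w [Cw|mw].
    by apply: subset_jones; left.
  by apply: (jones_subset _ _ mw) => v ->; right.
Qed.

End fat_image.

(** * Contradiction from a decomposition of X *)

Theorem theorem3p12 (R : realType) (X : metricType R)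
  (cX : continuum [set: X])
  (Tcont : continuous (@jones_hyperspace R X cX))
  (p : X) (Tp : (jones [set p])° !=set0) :
  indecomposable X.
Proof.
move=> [A [B [cA cB AT BT AB]]].
set U := (jones [set p])° in Tp.
have oU : open U by exact: open_interior.
have Up : U `<=` jones [set p] by exact: interior_subset.
(* If [U] is not inside [A], the nonempty open set U \ A lies in [B]. *)
have [W0 [cW0 W0T W0U]] :
    exists W, [/\ continuum W, W `<` [set: X] & W° `&` U !=set0].
  have [UA|] := pselect (U `<=` A).
    exists A; split=> //; have [u Uu] := Tp; exists u; split=> //.
    by apply: filterS UA _; exact: open_nbhs_nbhs.
  move=> /existsNP[u /not_implyP[Uu Au]]; exists B; split=> //; exists u; split=> //.
  have : nbhs u (~` A).
    apply: open_nbhs_nbhs; split=> //; apply: closed_openC.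
    exact: continuum_closed cA.
  by apply: filterS => x Ax; have [] : (A `|` B) x by rewrite AB.
have W0p := interior_meet_mem cX Tcont Up cW0 W0U.
have [y W0y] : exists y, ~ W0 y.
  by apply/existsNP => W0A; case: W0T => _; apply => y _; exact: W0A.
have yp : ~ jones [set y] p.
  by move=> /jones_meet /(_ cW0 W0p)[w [+ wy]]; rewrite wy.
have T0 : jones_closed (set0 : set X) by rewrite /jones_closed (jones0 cX).
have U0 : ~ U `<=` set0 by have [u Uu] := Tp => /(_ _ Uu).
have [|W1 [cW1 W1p _ UW1]] := ex_continuum_nsubset cX Tcont oU Up T0 U0 (x := y).
  by rewrite set0U.
have [u Uu W1u] : exists2 u, U u & ~ W1 u.
  by have /existsNP[u /not_implyP[Uu]] := UW1; rewrite set0U; exists u.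
have up : ~ jones [set u] p.
  by move=> /jones_meet /(_ cW1 W1p)[w [+ wu]]; rewrite wu.
(* The point [u] lies below [p], but [p] is not below [u]. *)
have Mp : ~ jones_minimal p by move=> /(_ _ (Up _ Uu)).
have clM := closed_jones_minimal cX Tcont.
have clMU : closed (jones_minimal `&` ~` U).
  by apply: closedI => //; exact: open_closedC.
have [F [TF _ FM Fmax]] := ex_maximal_jones_closed cX Tcont clMU T0 (@sub0set _ _).
have [G [TG FG GM Gmax]] :=
  ex_maximal_jones_closed cX Tcont clM TF (fun x Fx => (FM x Fx).1).
have Gp : ~ jones G p by move=> /TG /GM.
have [W [cW Wp WG]] := jonesPn Gp.
(* When [U] is inside [G], the continuum [W] misses [U], so the set added to [F] stays outside [U];
   and [U] is disjoint from both [F] and [W]. *)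
have [UG|UG] := pselect (U `<=` G).
  have WF : W `<=` ~` F by move=> x /WG Gx /FG.
  have UFW : ~ U `<=` F `|` W.
    by have := Uu => /[swap] /[apply] -[/FM[]//|/WG]; apply; exact: UG.
  have [N [[n Nn] NW NM TFN]] := ex_jones_closedU cX Tcont oU Up TF cW Wp WF UFW.
  apply: (WF n (NW _ Nn)); apply: (Fmax _ TFN); first by move=> x; left.
    move=> x [/FM//|Nx]; split; first exact: NM.
    by move=> /UG; apply: WG; exact: NW.
  by right.
(* Any point of [G] serves, since adding it changes nothing; for empty [G] the point [y] does. *)
have [x xp] : exists x, ~ jones (G `|` [set x]) p.
  have [[g Gg]|G0] := pselect (G !=set0).
    by exists g; rewrite (_ : G `|` [set g] = G)//; apply/setUidPl => x ->.
  exists y; rewrite (_ : G = set0) ?set0U//; apply/seteqP; split=> // x Gx.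
  by apply: G0; exists x.
have [W' [cW' W'p W'G UGW']] := ex_continuum_nsubset cX Tcont oU Up TG UG xp.
have [N [[n Nn] NW NM TGN]] := ex_jones_closedU cX Tcont oU Up TG cW' W'p W'G UGW'.
apply: (W'G n (NW _ Nn)); apply: (Gmax _ TGN); [by move=> z; left| |by right].
by move=> z [/GM|/NM].
Qed.
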